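(* Let $G=(V_1,E_1)$ be a connected graph with $|V_1|\ge 2$ and $H=(V_2,E_2)$ an arbitrary graph with $|V_2|\ge 1$ and adjacency matrix $A_H$. If the following two conditions are satisfied: (i) $-2-\psi_{H*}^{-1}(\mathrm{QEC}(G))\notin\mathrm{ev}(A_H)$; (ii) $\min\mathrm{ev}(A_H)> -\sqrt{2}$; then \[ \mathrm{QEC}(G\odot H)=\psi_{H*}^{-1}(\mathrm{QEC}(G)). \]
   Context: All graphs are finite, simple and undirected. For a connected graph $G=(V,E)$ with $|V|\ge2$ and distance matrix $D=[d(x,y)]_{x,y\in V}$ (graph distance), $\mathrm{QEC}(G)=\max\{\langle f,Df\rangle\,;\, f\in C(V),\ \langle f,f\rangle=1,\ \langle \mathbf{1},f\rangle=0\}$, where $C(V)$ is the space of real column vectors indexed by $V$ with the canonical inner product and $\mathbf{1}$ is the all-one vector. Corona: for graphs $G=(V_1,E_1)$, $H=(V_2,E_2)$ with $V_1\cap V_2=\emptyset$, $G\odot H$ is obtained from $G$ and $|V_1|$ disjoint copies of $H$ (one for each vertex of $G$) by joining each vertex of $G$ to every vertex of its copy of $H$. Functions associated with $H$: let $A_H$ be the adjacency matrix of $H$, $\mathrm{ev}(A_H)$ the set of its distinct eigenvalues, $E_\alpha$ the orthogonal projection onto the eigenspace of $\alpha$ ($E_\alpha=0$ if $\alpha\notin\mathrm{ev}(A_H)$), and $\mathrm{ev}_{\mathrm{M}}(A_H)=\{\alpha\in\mathrm{ev}(A_H)\,;\,E_\alpha\mathbf{1}\ne0\}$ the set of main eigenvalues.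 The function $\omega_H$ is the maximal real analytic extension of $\lambda\mapsto 1+\lambda\langle\mathbf{1},(A_H+2+\lambda)^{-1}\mathbf{1}\rangle$ (scalars stand for multiples of $I$), i.e. \[ \omega_H(\lambda)=1+\|E_{-2}\mathbf{1}\|^2+\sum_{\alpha\in\mathrm{ev}_{\mathrm{M}}(A_H)\setminus\{-2\}}\frac{\lambda}{\alpha+2+\lambda}\|E_\alpha\mathbf{1}\|^2 \] on $\mathbb{R}\setminus\{-\alpha-2\,;\,\alpha\in\mathrm{ev}_{\mathrm{M}}(A_H)\setminus\{-2\}\}$. It has at least one real zero; $\lambda_*$ denotes its largest zero. The function $\psi_H$ is the unique real analytic function on $\mathbb{R}\setminus\{\omega_H=0\}$ with $\psi_H(\lambda)=\lambda/\omega_H(\lambda)$ (so $\psi_H(-\alpha-2)=0$ for $\alpha\in\mathrm{ev}_{\mathrm{M}}(A_H)\setminus\{-2\}$). The restriction $\psi_{H*}=\psi_H\restriction_{(\lambda_*,+\infty)}$ is a strictly increasing bijection onto $\mathbb{R}$, and $\psi_{H*}^{-1}:\mathbb{R}\to(\lambda_*,+\infty)$ is its inverse. *)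

(* Defs.v *)
From HB Require Import structures.
From mathcomp Require Import all_boot all_order all_algebra.
From mathcomp Require Import all_classical all_reals.

Set Implicit Arguments.
Unset Strict Implicit.
Unset Printing Implicit Defensive.

Import Order.TTheory GRing.Theory Num.Theory.

Local Open Scope classical_set_scope.
Local Open Scope ring_scope.

(** * Finite simple graphs *)

Record sgraph := SGraph {
  vertex :> finType;
  adj : rel vertex;
  adj_sym : symmetric adj;
  adj_irr : irreflexive adj }.

Definition connected_graph (G : sgraph) : Prop :=
  forall x y : G, connect (@adj G) x y.

Definition has_walk (G : sgraph) (x y : G) (k : nat) : bool :=
  [exists p : k.-tuple G, path (@adj G) x p && (last x p == y)].

(* When x and y are connected, a shortest walk has length less than the number
   of vertices, so that the search range is large enough; otherwise the value
   is #|G|. *)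
Definition dist (G : sgraph) (x y : G) : nat :=
  find (has_walk x y) (iota 0 #|G|).

(* (x, u) is the copy of the vertex u of H in the copy of H attached to x. *)
Definition corona_adj (G H : sgraph) : rel (G + G * H)%type :=
  fun a b => match a, b with
  | inl x, inl y => adj x y
  | inl x, inr (y, _) => x == y
  | inr (x, _), inl y => x == y
  | inr (x, u), inr (y, v) => (x == y) && adj u v
  end.

Lemma corona_adj_sym (G H : sgraph) : symmetric (@corona_adj G H).
Proof.
move=> [x|[x u]] [y|[y v]] //=; first exact: adj_sym.
by rewrite eq_sym adj_sym.
Qed.

Lemma corona_adj_irr (G H : sgraph) : irreflexive (@corona_adj G H).
Proof. by move=> [x|[x u]] /=; rewrite adj_irr ?andbF. Qed.

Definition corona (G H : sgraph) : sgraph :=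
  SGraph (@corona_adj_sym G H) (@corona_adj_irr G H).

(** * Extrema of sets of reals *)

(* These are the greatest and the least element of A, not its supremum and
   infimum; the value is 0 when there is no such element. *)
Definition max_of (R : realType) (A : set R) : R :=
  xget 0 [set m | A m /\ ubound A m].

Definition min_of (R : realType) (A : set R) : R :=
  xget 0 [set m | A m /\ lbound A m].

(** * The quadratic embedding constant *)

(* Column vectors and matrices indexed by the vertices of G are indexed here by
   'I_#|G|, through the enumeration enum_val of the vertices. *)

Definition inner (R : realType) (n : nat) (f g : 'cV[R]_n) : R :=
  \sum_i f i 0 * g i 0.

Definition allone (R : realType) (n : nat) : 'cV[R]_n := const_mx 1.

Definition dist_mx (R : realType) (G : sgraph) : 'M[R]_#|G| :=
  \matrix_(i, j) (dist (enum_val i) (enum_val j))%:R.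

Definition QEC (R : realType) (G : sgraph) : R :=
  max_of [set inner f (dist_mx R G *m f) | f in
    [set f : 'cV[R]_#|G| | inner f f = 1 /\ inner (allone R #|G|) f = 0]].

(** * Main eigenvalues *)

Definition adj_mx (R : realType) (H : sgraph) : 'M[R]_#|H| :=
  \matrix_(i, j) (adj (enum_val i) (enum_val j))%:R.

Definition ev (R : realType) (H : sgraph) : set R :=
  [set a | eigenvalue (adj_mx R H) a].
Arguments ev : clear implicits.

(* [eigenspace A a] is a matrix whose rows span the eigenspace U of a (left and
   right eigenvectors agree since A is symmetric), and the row space of
   [kermx U^T] is the orthogonal complement of U.  [proj_mx] acts on row
   vectors, hence the transposition.  If a is not an eigenvalue, then U = 0 and
   the projection is 0. *)
Definition eigenproj (R : realType) (H : sgraph) (a : R) : 'M[R]_#|H| :=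
  let U := eigenspace (adj_mx R H) a in (proj_mx U (kermx U^T))^T.

Definition eigenproj1 (R : realType) (H : sgraph) (a : R) : 'cV[R]_#|H| :=
  eigenproj H a *m allone R #|H|.

Definition main_ev (R : realType) (H : sgraph) : set R :=
  [set a | ev R H a /\ eigenproj1 H a != 0].
Arguments main_ev : clear implicits.

(** * The functions omega_H and psi_H *)

Definition omega_poles (R : realType) (H : sgraph) : set R :=
  [set - a - 2 | a in main_ev R H `\ (- 2)].
Arguments omega_poles : clear implicits.

(* The value at a point of [omega_poles] is meaningless, as 0^-1 = 0; these
   points do not belong to the domain of omega_H and they are excluded below
   wherever omega_H is used. *)
Definition omega (R : realType) (H : sgraph) (l : R) : R :=
  1 + inner (eigenproj1 H (- 2)) (eigenproj1 H (- 2)) +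
  \sum_(a \in main_ev R H `\ (- 2))
     l / (a + 2 + l) * inner (eigenproj1 H a) (eigenproj1 H a).

Definition omega_zeros (R : realType) (H : sgraph) : set R :=
  [set l | ~ omega_poles R H l /\ omega H l = 0].
Arguments omega_zeros : clear implicits.

Definition lambda_star (R : realType) (H : sgraph) : R :=
  max_of (omega_zeros R H).

(* The poles of omega_H are removable singularities of l / omega_H(l), with
   value 0.  The value at a point of [omega_zeros], which is outside the domain
   of psi_H, is meaningless. *)
Definition psi (R : realType) (H : sgraph) (l : R) : R :=
  if `[< omega_poles R H l >] then 0 else l / omega H l.

(* The inverse of the restriction of psi_H to the open half-line above
   [lambda_star]. *)
Definition psi_star_inv (R : realType) (H : sgraph) : R -> R :=
  'pinv_(fun=> 0) [set l | lambda_star R H < l] (psi H).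

(* Main.v *)
Require Import Defs.
From HB Require Import structures.
From mathcomp Require Import all_boot all_order all_algebra.
From mathcomp Require Import all_classical all_reals.
From mathcomp Require Import topology normedtype derive.
From mathcomp Require Import ring lra.
Import Order.TTheory GRing.Theory Num.Theory.
Local Open Scope ring_scope.

(** Write a vector on the corona as [g] on G and [h_x] on the copy of H at [x],
    and put [T_x = g_x + <1, h_x>].  If the entries of the vector sum to 0, then
    its distance form is [<T, D_G T> - sum_x <h_x, (A_H + 2) h_x>] and its squared
    norm is [sum_x (T_x - <1, h_x>)^2 + |h_x|^2].  For [l > lambda_star] with
    [A_H + 2 + l] positive definite, the minimum over [h] of
    [<h, (A_H + 2 + l) h> + l (t - <1, h>)^2] is [psi_H(l) t^2], attained at a
    multiple of [(A_H + 2 + l)^-1 1].  Hence the distance form minus [l] times the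
    squared norm is at most [<T, D_G T> - psi_H(l) |T|^2], which for
    [psi_H(l) = QEC(G)] is nonpositive and vanishes for some nonzero [T].

    Positive definiteness comes from condition (ii): QEC(G) >= -1, while
    [psi_H(-2 + sqrt 2) <= -1] if [-2 + sqrt 2 > lambda_star], so that
    [l >= -2 + sqrt 2]. *)

Set Implicit Arguments.
Unset Strict Implicit.
Unset Printing Implicit Defensive.

(** * The inner product and the spectral theorem *)

Section Inner.
Context {R : realType} {n : nat}.
Implicit Types (f g h : 'cV[R]_n) (M : 'M[R]_n).

Lemma innerE f g : inner f g = (f^T *m g) 0 0.
Proof. by rewrite mxE; apply: eq_bigr => i _; rewrite mxE. Qed.

Lemma innerC f g : inner f g = inner g f.
Proof. by apply: eq_bigr => i _; rewrite mulrC. Qed.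

Lemma innerDl f g h : inner (f + g) h = inner f h + inner g h.
Proof. by rewrite /inner -big_split; apply: eq_bigr => i _; rewrite mxE mulrDl. Qed.

Lemma innerZl a f g : inner (a *: f) g = a * inner f g.
Proof. by rewrite /inner mulr_sumr; apply: eq_bigr => i _; rewrite mxE mulrA. Qed.

Lemma innerDr f g h : inner h (f + g) = inner h f + inner h g.
Proof. by rewrite innerC innerDl !(innerC h). Qed.

Lemma innerZr a f g : inner g (a *: f) = a * inner g f.
Proof. by rewrite innerC innerZl innerC. Qed.

Lemma inner_suml I (r : seq I) P (F : I -> 'cV[R]_n) f :
  inner (\sum_(i <- r | P i) F i) f = \sum_(i <- r | P i) inner (F i) f.
Proof.
elim/big_rec2: _ => [|i x y _ <-]; last by rewrite innerDl.
by rewrite /inner big1 // => i _; rewrite mxE mul0r.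
Qed.

Lemma inner_sumr I (r : seq I) P (F : I -> 'cV[R]_n) f :
  inner f (\sum_(i <- r | P i) F i) = \sum_(i <- r | P i) inner f (F i).
Proof. by rewrite innerC inner_suml; apply: eq_bigr => i _; rewrite innerC. Qed.

Lemma inner_ge0 f : 0 <= inner f f.
Proof. by apply: sumr_ge0 => i _; rewrite -expr2 sqr_ge0. Qed.

Lemma inner_eq0 f : (inner f f == 0) = (f == 0).
Proof.
apply/eqP/eqP => [|->]; last by rewrite /inner big1 // => i _; rewrite mxE mul0r.
move/eqP; rewrite psumr_eq0 => [/allP fi0|i _]; last by rewrite -expr2 sqr_ge0.
apply/colP => i; rewrite mxE; apply/eqP.
by have := fi0 i (mem_index_enum i); rewrite /= mulf_eq0 orbb.
Qed.

Lemma inner_gt0 f : (0 < inner f f) = (f != 0).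
Proof. by rewrite lt_def inner_ge0 andbT inner_eq0. Qed.

Lemma inner_symmx M f g : M^T = M -> inner f (M *m g) = inner (M *m f) g.
Proof. by move=> symM; rewrite !innerE trmx_mul symM mulmxA. Qed.

End Inner.

(** * Maxima of quadratic forms on the unit sphere of a subspace *)

Section Rayleigh.
Import numFieldNormedType.Exports.
Local Open Scope classical_set_scope.
Context {R : realType}.

Lemma continuous_inner_mulmx n p (A B : 'M[R]_(p, n)) :
  continuous (fun u : 'rV[R]_n => inner (A *m u^T) (B *m u^T)).
Proof.
have cmul (C : 'M[R]_(p, n)) i : continuous (fun u : 'rV[R]_n => (C *m u^T) i 0).
  rewrite (_ : (fun u => _) = (fun u : 'rV[R]_n => \sum_j C i j * u 0 j)); last first.
    by apply/funext => u; rewrite mxE; apply: eq_bigr => j _; rewrite !mxE.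
  refine (continuous_big (@add_continuous R) _) => j _ u.
  by apply: continuousM; [exact: cst_continuous|exact: coord_continuous].
refine (continuous_big (@add_continuous R) _) => j _ u.
by apply: continuousM; exact: cmul.
Qed.

(** The unit sphere of [ker C] is compact, and homogeneity carries the bound from unit vectors to
    all of [ker C]. The constraint serves twice: [C] is the all-one row for [QEC], and spans a sum
    of eigenspaces for the spectral theorem. *)
Lemma rayleigh_max n p (M : 'M[R]_n) (C : 'M[R]_(p, n)) (f0 : 'cV[R]_n) :
  f0 != 0 -> C *m f0 = 0 ->
  exists f : 'cV[R]_n, [/\ C *m f = 0, inner f f = 1 &
    forall g, C *m g = 0 -> inner g (M *m g) <= inner f (M *m f) * inner g g].
Proof.
move=> f0_neq0 Cf0.
have normalize (g : 'cV[R]_n) : g != 0 ->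
    inner ((Num.sqrt (inner g g))^-1 *: g) ((Num.sqrt (inner g g))^-1 *: g) = 1.
  move=> g0; have gg : inner g g != 0 by rewrite inner_eq0.
  rewrite innerZl innerZr mulrA -expr2 exprVn sqr_sqrtr ?inner_ge0 //.
  by rewrite mulVf.
pose F (u : 'rV[R]_n) := inner (1%:M *m u^T) (M *m u^T).
pose N (u : 'rV[R]_n) := inner (1%:M *m u^T) (1%:M *m u^T).
(* Both conditions are equations between continuous real functions, so [K] is closed; it lies in a
   box with sides [-1, 1]. *)
pose K := [set u | inner (C *m u^T) (C *m u^T) = 0] `&` [set u | N u = 1].
have K0 : K !=set0.
  exists (((Num.sqrt (inner f0 f0))^-1 *: f0)^T); split; rewrite /= /N ?mul1mx trmxK.
    by apply/eqP; rewrite inner_eq0 -scalemxAr Cf0 scaler0.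
  exact: normalize.
have cK : compact K.
  pose J : set R := `[-1, 1]%classic.
  apply: (@subclosed_compact 'rV[R]_n K [set u : 'rV[R]_n | forall i, J (u ord0 i)]).
  - apply: closedI.
      apply: (@closed_comp _ _ (fun u : 'rV[R]_n => inner (C *m u^T) (C *m u^T))
               [set x | x = 0]); last exact: closed_eq.
      by move=> u _; exact: continuous_inner_mulmx.
    apply: (@closed_comp _ _ N [set x | x = 1]); last exact: closed_eq.
    by move=> u _; exact: continuous_inner_mulmx.
  - apply: (@rV_compact R n (fun=> J)) => _; exact: segment_compact.
  move=> u [_ /= Nu] i; 
  have : u 0 i ^+ 2 <= 1.
    rewrite -Nu /N mul1mx /inner (bigD1 i) //= mxE expr2 lerDl.
    by apply: sumr_ge0 => j _; rewrite -expr2 sqr_ge0.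
  by rewrite /J /= in_itv /= => ui; apply/andP; split; nra.
have [u /set_mem[/= Cu Nu] umax] :=
  compact_EVT_max K0 cK (continuous_subspaceT (@continuous_inner_mulmx _ _ 1%:M M)).
rewrite mul1mx in umax; rewrite /N mul1mx in Nu.
move/eqP: Cu; rewrite inner_eq0 => /eqP Cu.
exists u^T; split=> // g Cg.
have [->|g0] := eqVneq g 0.
  by rewrite mulmx0 (eqP (_ : inner (0 : 'cV[R]_n) 0 == 0)) ?inner_eq0 ?mulr0.
set a := (Num.sqrt (inner g g))^-1.
have /umax : (a *: g)^T \in K.
  apply/mem_set; split; rewrite /= /N ?mul1mx trmxK ?normalize //.
  by apply/eqP; rewrite inner_eq0 -scalemxAr Cg scaler0.
rewrite trmxK !mul1mx -scalemxAr innerZl innerZr mulrA -expr2 exprVn.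
rewrite sqr_sqrtr ?inner_ge0 // mulrC -ler_pdivlMr ?invr_gt0 ?inner_gt0 //.
by rewrite invrK.
Qed.

End Rayleigh.

(** Applied to a characteristic polynomial, this lists the eigenvalues, so that sums over them
    become sums over a sequence. Roots are split off one at a time, each lowering the degree. *)
Lemma poly_root_seq (F : fieldType) (p : {poly F}) :
  p != 0 -> exists2 s : seq F, uniq s & root p =i s.
Proof.
have [n] := ubnP (size p); elim: n p => // n IHn p /ltnSE le_p p0.
have [[a pa]|noroot] := pselect (exists a, root p a); last first.
  by exists [::] => // a; rewrite in_nil; apply/negP => pa; apply: noroot; exists a.
have /factor_theorem[q pE] := pa.
have q0 : q != 0 by apply: contraNneq p0 => q0; rewrite pE q0 mul0r.
have [|s us qs] := IHn q _ q0.
  by move: le_p; rewrite pE size_Mmonic ?monicXsubC // size_XsubC addn2.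
exists (undup (a :: s)) => [|b]; first exact: undup_uniq.
by rewrite mem_undup in_cons -qs -!topredE /= pE rootM root_XsubC orbC.
Qed.

(** * Spectral decomposition of real symmetric matrices *)

Section Spectral.
Context {R : realType}.

(** A maximiser of the Rayleigh quotient on the invariant subspace [ker C] is an eigenvector: the
    residual [g] lies in [ker C] too, and if it were nonzero, a small move along it would increase
    the quotient. *)
Lemma symmx_eigenvector n p (M : 'M[R]_n) (C : 'M[R]_(p, n)) (f0 : 'cV[R]_n) :
  M^T = M -> (forall g : 'cV[R]_n, C *m g = 0 -> C *m (M *m g) = 0) ->
  f0 != 0 -> C *m f0 = 0 ->
  exists a (f : 'cV[R]_n), [/\ f != 0, C *m f = 0 & M *m f = a *: f].
Proof.
move=> symM invC f0_neq0 Cf0.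
have [f [Cf ff fmax]] := rayleigh_max M f0_neq0 Cf0.
set a := inner f (M *m f) in fmax.
exists a, f; split=> //; first by rewrite -inner_eq0 ff oner_eq0.
pose g := M *m f - a *: f; apply/eqP; rewrite -subr_eq0 -/g -inner_eq0.
have Cg : C *m g = 0 by rewrite mulmxBr invC // -scalemxAr Cf scaler0 subrr.
have gMf : inner g (M *m f) = a * inner g f + inner g g.
  rewrite -[X in _ + X](_ : inner g (M *m f + (- a) *: f) = _); last by rewrite scaleNr.
  by rewrite innerDr innerZr; ring.
clearbody g; pose k := a * inner g g - inner g (M *m g).
(* [f + t g] is admissible for every [t], so the first-order term vanishes *)
have main t : t * inner g g * 2 <= t ^+ 2 * k.
  have /fmax : C *m (f + t *: g) = 0 by rewrite mulmxDr -scalemxAr Cf Cg scaler0 addr0.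
  rewrite mulmxDr -scalemxAr !(innerDl, innerDr, innerZl, innerZr).
  rewrite (inner_symmx f g symM) (innerC (M *m f) g) (innerC f g) gMf ff -/a /k.
  move=> h; rewrite -subr_ge0 in h; rewrite -subr_ge0; move: h.
  by congr (0 <= _); ring.
apply/eqP/le_anti; rewrite inner_ge0 andbT leNgt; apply/negP => gg0.
have K0 : 0 < `|k| + 1 by rewrite ltr_wpDl.
(* For this [t], [inner g g] is [t * (|k| + 1)], and [main] would give [2 * (|k| + 1) <= k]. *)
have := main (inner g g / (`|k| + 1)).
have t0 : 0 < inner g g / (`|k| + 1) by rewrite divr_gt0.
set t := _ / _ in t0 *.
have tE : inner g g = t * (`|k| + 1) by rewrite /t divfK ?gt_eqF.
have := ler_norm k.
rewrite tE => hk; rewrite expr2 -subr_le0 leNgt; move/negP; apply.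
rewrite (_ : _ - _ = t * (t * (2 * (`|k| + 1) - k))); last by ring.
by rewrite pmulr_rgt0 // pmulr_rgt0 // subr_gt0; have := normr_ge0 k; lra.
Qed.

(** The orthogonal complement of the sum [S] of the eigenspaces is invariant under [M]. If nonzero,
    it contains an eigenvector, which also lies in [S] and is therefore orthogonal to itself. *)
Lemma symmx_eigenspace_full n (M : 'M[R]_n) (s : seq R) :
  M^T = M -> (forall a, eigenvalue M a -> a \in s) ->
  (1%:M <= \sum_(i < size s) eigenspace M s`_i)%MS.
Proof.
move=> symM evs; set S := (X in (_ <= X)%MS); rewrite sub1mx -cokermx_eq0.
apply/negPn/negP => coS; have [j colj] : exists j, col j (cokermx S) != 0.
  apply/existsP; apply: contraNT coS; rewrite negb_exists => /forallP col0.
  by apply/eqP/matrixP => i j; have /negPn/eqP/colP/(_ i) := col0 j; rewrite !mxE.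
have Sj : S *m col j (cokermx S) = 0 by rewrite colE mulmxA mulmx_coker mul0mx.
have invS (g : 'cV[R]_n) : S *m g = 0 -> S *m (M *m g) = 0.
  have /submxP[X SM] : (S *m M <= S)%MS.
    rewrite /S sumsmxMr; apply/sumsmx_subP => i _.
    rewrite (eigenspaceP (submx_refl _)).
    by rewrite (submx_trans (scalemx_sub _ (submx_refl _))) // (sumsmx_sup i).
  by move=> Sg; rewrite mulmxA SM -mulmxA Sg mulmx0.
have [a [f [f0 Sf Mf]]] := symmx_eigenvector symM invS colj Sj.
have fM : f^T *m M = a *: f^T by rewrite -{1}symM -trmx_mul Mf linearZ.
have /evs sa : eigenvalue M a by apply/eigenvalueP; exists f^T => //; rewrite trmx_eq0.
have lt_a : (index a s < size s)%N by rewrite index_mem.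
have /submxP[X fE] : (f^T <= S)%MS.
  by apply: (sumsmx_sup (Ordinal lt_a)) => //=; rewrite nth_index //; apply/eigenspaceP.
by move: f0; rewrite -inner_eq0 innerE fE -mulmxA Sf mulmx0 mxE eqxx.
Qed.

Context {H : sgraph}.
Local Notation A := (adj_mx R H).

Lemma adj_mx_sym : A^T = A.
Proof. by apply/matrixP => i j; rewrite !mxE adj_sym. Qed.

Lemma eigenspace_colP a m (W : 'M[R]_(#|H|, m)) :
  reflect (A *m W = a *: W) (W^T <= eigenspace A a)%MS.
Proof.
apply: (iffP eigenspaceP) => E; last first.
  by move/(congr1 trmx): E; rewrite trmx_mul adj_mx_sym linearZ.
by apply: trmx_inj; rewrite trmx_mul adj_mx_sym E linearZ.
Qed.

Lemma inner_eigen_neq a b (u v : 'cV[R]_#|H|) :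
  A *m u = a *: u -> A *m v = b *: v -> a != b -> inner u v = 0.
Proof.
move=> Au Av ab; have := inner_symmx u v adj_mx_sym.
rewrite Au Av innerZr innerZl => /eqP.
by rewrite -subr_eq0 -mulrBl mulf_eq0 subr_eq0 eq_sym (negPf ab) => /eqP.
Qed.

Lemma eigenproj_eigen a (v : 'cV[R]_#|H|) :
  A *m (eigenproj H a *m v) = a *: (eigenproj H a *m v).
Proof. by apply/eigenspace_colP; rewrite trmx_mul trmxK proj_mx_sub. Qed.

(** Lets [proj_mx] be computed from its values on the eigenspace and on the complement. A common
    vector is orthogonal to itself. *)
Lemma eigenspace_capC a :
  (eigenspace A a :&: kermx (eigenspace A a)^T = 0)%MS.
Proof.
apply/eqP; rewrite -submx0; apply/rV_subP => v.
rewrite sub_capmx sub_kermx => /andP[/submxP[w vE] /eqP vU].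
have : inner v^T v^T = 0 by rewrite innerE trmxK {2}vE trmx_mul mulmxA vU mul0mx mxE.
by move/eqP; rewrite inner_eq0 => /eqP v0; rewrite submx0 -[v]trmxK v0 trmx0.
Qed.

Lemma eigenproj_uniq a (u v : 'cV[R]_#|H|) :
  A *m u = a *: u -> (forall w, A *m w = a *: w -> inner w v = 0) ->
  eigenproj H a *m (u + v) = u.
Proof.
move=> /eigenspace_colP Uu vU; apply: trmx_inj; rewrite trmx_mul trmxK linearD /= mulmxDl.
rewrite (proj_mx_id (eigenspace_capC a)) // proj_mx_0 ?eigenspace_capC ?addr0 //.
rewrite sub_kermx -trmx_mul; apply/eqP/trmx_inj; rewrite trmx0 trmxK.
apply/row_matrixP => i; rewrite row0 row_mul.
have /vU : A *m (row i (eigenspace A a))^T = a *: (row i (eigenspace A a))^T.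
  by apply/eigenspace_colP; rewrite trmxK row_sub.
rewrite innerE trmxK => h; apply/matrixP => x y; rewrite !ord1 h mxE //.
Qed.

(** [v] is a sum of vectors [w i], one in each eigenspace; they are mutually orthogonal, so the i-th
    projection of [v] is exactly [w i]. *)
Lemma sum_eigenproj (s : seq R) (v : 'cV[R]_#|H|) :
  uniq s -> (forall a, eigenvalue A a -> a \in s) ->
  \sum_(a <- s) eigenproj H a *m v = v.
Proof.
move=> us evs.
have /sub_sumsmxP[u uE] : (v^T <= \sum_(i < size s) eigenspace A s`_i)%MS.
  by apply: submx_trans (submx1 _) (symmx_eigenspace_full adj_mx_sym evs).
pose w (i : 'I_(size s)) := (u i *m eigenspace A s`_i)^T.
have vE : v = \sum_i w i by rewrite -[v]trmxK uE linear_sum.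
have Aw i : A *m w i = s`_i *: w i by apply/eigenspace_colP; rewrite trmxK submxMl.
rewrite (big_nth 0) big_mkord {2}vE; apply: eq_bigr => i _.
rewrite vE (bigD1 i) //=; apply: eigenproj_uniq => // z Az.
rewrite inner_sumr big1 // => j ji; apply: (inner_eigen_neq Az (Aw j)).
by rewrite nth_uniq // eq_sym.
Qed.

End Spectral.

(** * Distances in a corona *)

Section Distance.
Local Open Scope nat_scope.
Implicit Types G H : sgraph.

Lemma has_walkP G (x y : G) k :
  reflect (exists p : seq G, [/\ size p = k, path (@adj G) x p & last x p = y])
          (has_walk x y k).
Proof.
apply: (iffP existsP) => [[p /andP[xp /eqP py]]|[p [sp xp py]]].
  by exists p; rewrite size_tuple.
by exists (Tuple (introT eqP sp)); rewrite /= xp py eqxx.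
Qed.

Lemma has_walk0 G (x : G) : has_walk x x 0.
Proof. by apply/has_walkP; exists [::]. Qed.

Lemma has_walk_cons G (x x' y : G) k :
  adj x x' -> has_walk x' y k -> has_walk x y k.+1.
Proof.
move=> xx' /has_walkP[p [sp xp py]]; apply/has_walkP.
by exists (x' :: p); rewrite /= sp xx' xp.
Qed.

Lemma has_walk_rcons G (x y y' : G) k :
  has_walk x y k -> adj y y' -> has_walk x y' k.+1.
Proof.
move=> /has_walkP[p [sp xp py]] yy'; apply/has_walkP.
by exists (rcons p y'); rewrite size_rcons sp rcons_path xp last_rcons py.
Qed.

(** Shortening a walk to one without repeated vertices puts the least length below [#|G|], inside
    the range searched by [find]. *)
Lemma dist_unique G (x y : G) k :
  has_walk x y k -> (forall j, has_walk x y j -> k <= j) -> dist x y = k.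
Proof.
move=> xyk kmin; have lt_k : k < #|G|.
  have /has_walkP[p [_ xp py]] := xyk.
  case/shortenP: xp py => q xq uq _ qy.
  have /kmin/leq_ltn_trans -> // : has_walk x y (size q) by apply/has_walkP; exists q.
  by rewrite -/(size (x :: q)) -(card_uniqP uq); exact: max_card.
rewrite /dist; set s := iota 0 #|G|.
have hs : has (has_walk x y) s by apply/hasP; exists k; rewrite ?mem_iota.
have lt_find : find (has_walk x y) s < #|G| by rewrite -[X in _ < X](size_iota 0) -has_find.
apply/eqP; rewrite eqn_leq; apply/andP; split.
  rewrite leqNgt; apply/negP => /(before_find 0).
  by rewrite nth_iota // add0n xyk.
by apply: kmin; have := nth_find 0 hs; rewrite nth_iota // add0n.
Qed.

Section Connected.
Context (G : sgraph) (G_connected : connected_graph G).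
Implicit Types x y z : G.

Lemma distP x y :
  has_walk x y (dist x y) /\ (forall j, has_walk x y j -> dist x y <= j).
Proof.
have ex : exists k, has_walk x y k.
  have /connectP[p xp ->] := G_connected x y.
  by exists (size p); apply/has_walkP; exists p.
by case: (ex_minnP ex) => k xyk kmin; rewrite (dist_unique xyk kmin).
Qed.

Lemma dist_refl x : dist x x = 0.
Proof. by apply: dist_unique; rewrite ?has_walk0. Qed.

Lemma dist_adj_leq x x' y : adj x x' -> dist x y <= (dist x' y).+1.
Proof.
move=> xx'; have [walk _] := distP x' y; have [_] := distP x y; apply.
exact: has_walk_cons walk.
Qed.

Lemma dist_adj x y : adj x y -> dist x y = 1.
Proof.
move=> xy; apply: dist_unique; first exact: has_walk_cons xy (has_walk0 y).
case=> // /has_walkP[p [/size0nil-> _ /= xy']].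
by rewrite xy' adj_irr in xy.
Qed.

(** A copy is attached to the rest only through its vertex of G: two of its vertices are at distance
    at most 2 through that vertex, and each end of a path between different copies costs one extra
    step. *)
Definition corona_dist H (a b : corona G H) : nat :=
  match a, b with
  | inl x, inl y => dist x y
  | inl x, inr (y, _) => (dist x y).+1
  | inr (x, _), inl y => (dist x y).+1
  | inr (x, u), inr (y, v) =>
      if x == y then if u == v then 0 else if adj u v then 1 else 2
      else (dist x y).+2
  end.

(** The lower bound on distances: along a walk to [b], [corona_dist] drops by at most 1 per step and
    ends at 0. *)
Lemma corona_dist_adj_leq H (a a' b : corona G H) :
  adj a a' -> corona_dist a b <= (corona_dist a' b).+1.
Proof.
case: a a' b => [x|[x u]] [x'|[x' u']] [y|[y v]] //=.
- exact: dist_adj_leq.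
- by rewrite ltnS; exact: dist_adj_leq.
- by move/eqP<-; rewrite !leqW.
- by move/eqP<-; case: eqVneq => [->|_]; rewrite ?dist_refl ?ltnS // !leqW.
- by move/eqP<-.
- by move/eqP<-; case: eqVneq => [->|_] //; rewrite dist_refl; do 2?case: ifP.
- by case/andP => /eqP<-.
case/andP => /eqP<- uu'; case: (x == y) => //.
have [<-|u'v] := eqVneq u' v; first by rewrite uu'; case: ifP.
by case: ifP => //; case: ifP; case: ifP.
Qed.

Lemma corona_walk H (a b : corona G H) : has_walk a b (corona_dist a b).
Proof.
have walkG x y : has_walk (inl x : corona G H) (inl y) (dist x y).
  have [/has_walkP[p [sp xp py]] _] := distP x y; apply/has_walkP.
  exists (map (inl : G -> corona G H) p); split; rewrite ?size_map //.
    by rewrite path_map.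
  by rewrite last_map py.
have down x u : adj (inl x : corona G H) (inr (x, u)) by rewrite /= eqxx.
have up x u : adj (inr (x, u) : corona G H) (inl x) by rewrite /= eqxx.
case: a b => [x|[x u]] [y|[y v]] /=.
- exact: walkG.
- exact: has_walk_rcons (walkG _ _) (down _ _).
- exact: has_walk_cons (up _ _) (walkG _ _).
case: eqVneq => [<-|_].
  case: eqVneq => [->|_]; first exact: has_walk0.
  case: ifP => [uv|_].
    by apply: has_walk_cons (has_walk0 _); rewrite /= eqxx uv.
  exact: has_walk_cons (up _ _) (has_walk_cons (down _ _) (has_walk0 _)).
exact: has_walk_rcons (has_walk_cons (up _ _) (walkG _ _)) (down _ _).
Qed.

Lemma dist_corona H (a b : corona G H) : dist a b = corona_dist a b.
Proof.
apply: dist_unique; first exact: corona_walk.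
move=> j /has_walkP[p [<- + <-]] {j b}; elim: p a => [|a' p IHp] a /=.
  by move=> _; case: a => [x|[x u]] /=; rewrite ?eqxx ?dist_refl.
move=> /andP[aa' /IHp]; rewrite -ltnS; apply: leq_trans.
exact: corona_dist_adj_leq.
Qed.

Lemma connected_edge : 2 <= #|G| -> exists x y, adj x y.
Proof.
move=> G2; have [x [y [_ _ xy]]] : exists x y, [/\ x \in G, y \in G & x != y].
  by have /card_gt1P := G2.
have /connectP[[|x' p] /= xp yE] := G_connected x y.
  by rewrite yE eqxx in xy.
by case/andP: xp => xx' _; exists x, x'.
Qed.

End Connected.
End Distance.

(** * The quadratic embedding constant *)

Section QEC.
Context {R : realType}.

Lemma max_of_eq (A : set R) m : A m -> ubound A m -> max_of A = m.
Proof.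
move=> Am mub; apply: xget_subset1 => // x y [Ax xub] [Ay yub].
by apply/le_anti; rewrite xub // yub.
Qed.

Lemma min_of_eq (A : set R) m : A m -> lbound A m -> min_of A = m.
Proof.
move=> Am mlb; apply: xget_subset1 => // x y [Ax xlb] [Ay ylb].
by apply/le_anti; rewrite xlb // ylb.
Qed.

Lemma sum_enum_val (T : finType) (F : T -> R) :
  \sum_(i < #|T|) F (enum_val i) = \sum_x F x.
Proof. by rewrite [RHS](reindex _ (onW_bij _ (@enum_val_bij T))). Qed.

(** Functions on the vertices replace vectors indexed by ordinals, so that sums over a corona split
    along its sum type. *)
Definition colfun (T : finType) (f : T -> R) : 'cV[R]_#|T| := \col_i f (enum_val i).

Lemma inner_colfun (T : finType) (f g : T -> R) :
  inner (colfun f) (colfun g) = \sum_x f x * g x.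
Proof. by rewrite -sum_enum_val; apply: eq_bigr => i _; rewrite !mxE. Qed.

Lemma inner1_colfun (T : finType) (f : T -> R) :
  inner (allone R #|T|) (colfun f) = \sum_x f x.
Proof. by rewrite -sum_enum_val; apply: eq_bigr => i _; rewrite !mxE mul1r. Qed.

Lemma colfunK (T : finType) (f : 'cV[R]_#|T|) :
  colfun (fun x => f (enum_rank x) 0) = f.
Proof. by apply/colP => i; rewrite mxE enum_valK. Qed.

Definition dist_form (G : sgraph) (f : G -> R) : R :=
  \sum_x \sum_y (dist x y)%:R * f x * f y.

Lemma inner_dist_mx (G : sgraph) (f : G -> R) :
  inner (colfun f) (dist_mx R G *m colfun f) = dist_form f.
Proof.
rewrite /dist_form -[RHS]sum_enum_val; apply: eq_bigr => i _.
rewrite !mxE -[RHS]sum_enum_val mulr_sumr; apply: eq_bigr => j _.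
by rewrite !mxE mulrA (mulrC (f _)).
Qed.

(** A homogeneous criterion: the extremal function need not be normalised, since the factor [c]
    below rescales it. *)
Lemma QEC_unique (G : sgraph) q (f : G -> R) :
  (forall g : G -> R, \sum_x g x = 0 -> dist_form g <= q * \sum_x g x ^+ 2) ->
  \sum_x f x = 0 -> \sum_x f x ^+ 2 != 0 -> dist_form f = q * \sum_x f x ^+ 2 ->
  QEC R G = q.
Proof.
move=> qub f1 fn0 fq; apply: max_of_eq.
  set s := \sum_x f x ^+ 2 in fn0 fq.
  have s0 : 0 < s by rewrite lt_def fn0 sumr_ge0 // => x _; exact: sqr_ge0.
  pose c := (Num.sqrt s)^-1.
  have c2 : c ^+ 2 = s^-1 by rewrite exprVn sqr_sqrtr // ltW.
  have ff : inner (colfun f) (colfun f) = s.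
    by rewrite inner_colfun; apply: eq_bigr => x _; rewrite expr2.
  exists (c *: colfun f); first split.
  - by rewrite innerZl innerZr mulrA -expr2 c2 ff mulVf.
  - by rewrite innerZr inner1_colfun f1 mulr0.
  by rewrite -scalemxAr innerZl innerZr mulrA -expr2 c2 inner_dist_mx fq; field.
move=> _ [g [gg g1] <-].
rewrite -(colfunK g) in gg g1 *.
rewrite inner_dist_mx; rewrite inner1_colfun in g1; apply: le_trans (qub _ g1) _.
rewrite (_ : \sum_x _ = 1) ?mulr1 // -gg inner_colfun.
by apply: eq_bigr => x _; rewrite expr2.
Qed.

Lemma QEC_max (G : sgraph) : (1 < #|G|)%N ->
  exists2 f : G -> R, [/\ \sum_x f x = 0, \sum_x f x ^+ 2 = 1 & dist_form f = QEC R G]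
  & forall g : G -> R, \sum_x g x = 0 -> dist_form g <= QEC R G * \sum_x g x ^+ 2.
Proof.
case/card_gt1P => a [b [_ _ ab]].
have C1 (g : 'cV[R]_#|G|) : (allone R #|G|)^T *m g = 0 <-> inner (allone R #|G|) g = 0.
  rewrite innerE; split=> [->|h]; first by rewrite mxE.
  by apply/matrixP => i j; rewrite !ord1 h mxE.
(* Two distinct vertices give a nonzero function of sum 0, so that the constraint space is not
   trivial. *)
pose f0 x : R := (x == a)%:R - (x == b)%:R.
have /(proj2 (C1 _)) f01 : inner (allone R #|G|) (colfun f0) = 0.
  rewrite inner1_colfun sumrB; apply/eqP; rewrite subr_eq0; apply/eqP.
  rewrite [LHS](bigD1 a) //= [RHS](bigD1 b) //= !eqxx.
  by rewrite !big1 // => x /negPf->.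
have f00 : colfun f0 != 0.
  apply/eqP => /colP/(_ (enum_rank a)); rewrite !mxE enum_rankK /f0 eqxx (negPf ab) subr0.
  by apply/eqP; rewrite oner_eq0.
have [f [/(proj1 (C1 _)) Cf ff fmax]] := rayleigh_max (dist_mx R G) f00 f01.
rewrite -(colfunK f) in Cf ff fmax.
set h := fun x => f (enum_rank x) 0 in Cf ff fmax.
rewrite inner_dist_mx in fmax; rewrite inner1_colfun in Cf.
have hh : \sum_x h x ^+ 2 = 1.
  by rewrite -ff inner_colfun; apply: eq_bigr => x _; rewrite expr2.
have hub (g : G -> R) : \sum_x g x = 0 -> dist_form g <= dist_form h * \sum_x g x ^+ 2.
  move=> g1; have /fmax : (allone R #|G|)^T *m colfun g = 0.
    by apply/C1; rewrite inner1_colfun.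
  rewrite inner_dist_mx inner_colfun.
  by under eq_bigr do rewrite -expr2.
rewrite (QEC_unique (q := dist_form h) (f := h)) ?hh ?mulr1 ?oner_eq0 //.
by exists h.
Qed.

(** On an edge [ab], the difference of the indicators of [a] and [b] has distance form -2 and
    squared norm 2. *)
Lemma QEC_geN1 (G : sgraph) : connected_graph G -> (1 < #|G|)%N -> -1 <= QEC R G.
Proof.
move=> cG G2; have [a [b ab]] := connected_edge cG G2.
have [_ _ qub] := QEC_max G2.
have neq_ab : a != b by apply: contraTneq ab => ->; rewrite adj_irr.
pose f x : R := (x == a)%:R - (x == b)%:R.
have sumf F : \sum_x F x * f x = F a - F b.
  under eq_bigr do rewrite mulrBr; rewrite sumrB; congr (_ - _).
    by rewrite (bigD1 a) //= eqxx mulr1 big1 ?addr0 // => x /negPf->; rewrite mulr0.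
  by rewrite (bigD1 b) //= eqxx mulr1 big1 ?addr0 // => x /negPf->; rewrite mulr0.
have f1 : \sum_x f x = 0.
  by under eq_bigr do rewrite -[f _]mul1r; rewrite (sumf (fun=> 1)) subrr.
have := qub _ f1.
have -> : \sum_x f x ^+ 2 = 2.
  under eq_bigr do rewrite expr2; rewrite sumf /f !eqxx (negPf neq_ab).
  by rewrite eq_sym (negPf neq_ab) /=; ring.
have -> : dist_form f = - 2.
  rewrite /dist_form; under eq_bigr => x _.
    under eq_bigr do rewrite -mulrA (mulrC (f x)) mulrA.
    rewrite -mulr_suml sumf; over.
  have ba : adj b a by rewrite adj_sym.
  by rewrite sumf /= !dist_refl // (dist_adj ab) (dist_adj ba); ring.
by move=> h; lra.
Qed.

End QEC.

(** * Functions of the form of omega_H *)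

Section PartialFraction.
Import numFieldNormedType.Exports.
Local Open Scope classical_set_scope.
Context {R : realType} {I : eqType} (s : seq I) (b c : I -> R).
Hypothesis b_gt0 : {in s, forall i, 0 < b i}.
Hypothesis c_gt0 : {in s, forall i, 0 < c i}.
Hypothesis s_neq0 : s != [::].

(** With [b a = a + 2] and [c a] the squared norm of the projection of the all-one vector, summed
    over the main eigenvalues, this is omega_H when -2 is not an eigenvalue. *)
Definition pfrac (l : R) : R := 1 + \sum_(i <- s) l / (b i + l) * c i.

(** The half-line to the right of all the poles [- b i]. *)
Local Notation dom x := {in s, forall i, 0 < b i + x}.

Lemma pfrac_dom_le x y : x <= y -> dom x -> dom y.
Proof. by move=> xy dx i si; apply: lt_le_trans (dx i si) _; rewrite lerD2l. Qed.

Lemma has_mem_seq : has [in s] s.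
Proof. by case: s s_neq0 => //= i t _; rewrite mem_head. Qed.

(** Each quotient is [1 - b i / (b i + l)], which increases with [l] because [b i > 0]. *)
Lemma pfrac_lt x y : dom x -> x < y -> pfrac x < pfrac y.
Proof.
move=> dx xy; rewrite ltrD2l big_seq_cond [ltRHS]big_seq_cond.
apply: ltr_sum => [|i /andP[si _]].
  by apply/hasP; have /hasP[i si _] := has_mem_seq; exists i; rewrite ?si.
have := dx _ si; have := pfrac_dom_le (ltW xy) dx si; have := b_gt0 si; have := c_gt0 si.
set B := b i; move=> c0 B0 By Bx; rewrite ltr_pM2r // -subr_gt0.
have -> : y / (B + y) - x / (B + x) = B * (y - x) / ((B + y) * (B + x)).
  by field; rewrite !gt_eqF.
by rewrite divr_gt0 ?mulr_gt0 // subr_gt0.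
Qed.

Lemma pfrac_ratio_lt x y :
  dom x -> 0 < pfrac x -> x < y -> x / pfrac x < y / pfrac y.
Proof.
move=> dx wx xy; have wy := lt_trans wx (pfrac_lt dx xy).
rewrite ltr_pdivrMr // mulrAC ltr_pdivlMr //.
(* If [x] and [y] have opposite signs, then [x < 0 < y] and the claim is clear. Otherwise the
   difference of the two sides is [y - x] plus nonnegative terms. *)
have [xy0|xy0] := leP 0 (x * y); last first.
  have x0 : x < 0 by nra.
  by apply: (@lt_trans _ _ 0); [rewrite nmulr_rlt0|rewrite pmulr_lgt0 //; nra].
rewrite -subr_gt0.
have -> : y * pfrac x - x * pfrac y = y - x +
    x * y * \sum_(i <- s) (y - x) / ((b i + x) * (b i + y)) * c i.
  rewrite /pfrac !mulrDr !mulr1 !mulr_sumr opprD addrACA -sumrN -big_split /=.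
  congr (_ + _); rewrite big_seq [RHS]big_seq; apply: eq_bigr => i si; field.
  by rewrite !gt_eqF ?(dx _ si) ?(pfrac_dom_le (ltW xy) dx si).
apply: ltr_wpDr; last by rewrite subr_gt0.
rewrite mulr_ge0 // big_seq sumr_ge0 // => i si.
have := dx _ si; have := pfrac_dom_le (ltW xy) dx si; have := c_gt0 si.
by move=> /ltW c0 By Bx; rewrite mulr_ge0 // divr_ge0 ?mulr_ge0 ?subr_ge0 // ltW.
Qed.

Lemma pfrac_continuous x : dom x -> {for x, continuous pfrac}.
Proof.
move=> dx; apply: cvgD; first exact: cvg_cst.
rewrite big_seq_cond.
under eq_cvg do rewrite big_seq_cond.
apply: (@cvg_big R _ +%R 0 _ (@add_continuous R)) => i /andP[si _].
apply: cvgM; last exact: cvg_cst.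
apply: cvgM; first exact: cvg_id.
apply: cvgV; first by rewrite gt_eqF // dx.
by apply: cvgD; [exact: cvg_cst|exact: cvg_id].
Qed.

(** The intermediate value theorem between 0, where the value is 1, and a point [x] between the
    rightmost pole [- b i] and 0, where the value is at most 0. *)
Lemma pfrac_zero : exists z, [/\ z < 0, dom z & pfrac z = 0].
Proof.
have [i si imin] : exists2 i, i \in s & {in s, forall j, b i <= b j}.
  have /hasP[i0 si0 _] := has_mem_seq.
  have lt0 : (index i0 s < size s)%N by rewrite index_mem.
  have [k _ kmin] := @Order.TotalTheory.arg_minP _ _ _ (Ordinal lt0) xpredT
    (fun k : 'I_(size s) => b (nth i0 s k)) isT.
  exists (nth i0 s k) => [|j sj]; first exact: mem_nth.
  have ltj : (index j s < size s)%N by rewrite index_mem.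
  by have := kmin (Ordinal ltj) isT; rewrite /= nth_index.
have bi0 := b_gt0 si; have ci0 := c_gt0 si.
(* at this point the term of index i is -1, and the other terms are nonpositive *)
pose x := - b i / (1 + c i).
have c10 : 0 < 1 + c i by rewrite addr_gt0.
have x0 : x < 0 by rewrite /x mulNr oppr_lt0 divr_gt0.
have bxE : b i + x = b i * c i / (1 + c i) by rewrite /x; field; rewrite gt_eqF.
have bx : 0 < b i + x by rewrite bxE divr_gt0 // mulr_gt0.
have dx : dom x by move=> j sj; apply: lt_le_trans bx _; rewrite lerD2r imin.
have wx : pfrac x <= 0.
  rewrite /pfrac (big_rem i) //= (_ : x / (b i + x) * c i = - 1); last first.
    by rewrite bxE /x; field; rewrite !gt_eqF.
  rewrite addrA subrr add0r big_seq; apply: sumr_le0 => j /mem_rem sj.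
  rewrite pmulr_lle0 ?c_gt0 // nmulr_rle0 // invr_ge0; exact: ltW (dx _ sj).
have w0 : pfrac 0 = 1 by rewrite /pfrac big1 ?addr0 // => j _; rewrite !mul0r.
have [||z] := @IVT R pfrac x 0 0 (ltW x0).
- apply: continuous_in_subspaceT => z; rewrite inE /= in_itv /= => /andP[xz _].
  exact: pfrac_continuous (pfrac_dom_le xz dx).
- by rewrite w0 ge_min wx le_max ler01 orbT.
rewrite in_itv /= => /andP[xz z0] wz; exists z; split=> //; last exact: pfrac_dom_le dx.
rewrite lt_neqAle z0 andbT; apply: contra_eq_neq wz => ->.
by rewrite w0 oner_eq0.
Qed.

(** The equation is solved as [l - q * pfrac l = 0], which is continuous at [z] as well. The left
    side is [z < 0] at [z] and nonnegative at [L], because [pfrac L <= C]. *)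
Lemma pfrac_ratio_surj z q : dom z -> z < 0 -> pfrac z = 0 ->
  exists2 l, z < l & l / pfrac l = q.
Proof.
move=> dz z0 wz; pose C := 1 + \sum_(i <- s) c i; pose L := `|q| * C.
have C0 : 0 <= C by rewrite addr_ge0 // big_seq sumr_ge0 // => i /c_gt0/ltW.
have L0 : 0 <= L by rewrite mulr_ge0.
have zL : z <= L := le_trans (ltW z0) L0.
pose f l := l - q * pfrac l.
have fz : f z = z by rewrite /f wz mulr0 subr0.
have fL : 0 <= f L.
  have wL : 0 <= pfrac L.
    by move: zL; rewrite le_eqVlt => /predU1P[<-|/(pfrac_lt dz)]; rewrite ?wz // => /ltW.
  rewrite subr_ge0 (le_trans (ler_wpM2r wL (ler_norm q))) // ler_wpM2l //.
  rewrite lerD2l big_seq [leRHS]big_seq; apply: ler_sum => i si.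
  have bL : 0 < b i + L := pfrac_dom_le zL dz si.
  rewrite ler_piMl ?(ltW (c_gt0 si)) // ler_pdivrMr // mul1r lerDr.
  exact: ltW (b_gt0 si).
have [||l] := @IVT R f z L 0 zL.
- apply: continuous_in_subspaceT => x; rewrite inE /= in_itv /= => /andP[zx _].
  apply: cvgB; first exact: cvg_id.
  apply: cvgM; first exact: cvg_cst.
  exact: pfrac_continuous (pfrac_dom_le zx dz).
- by rewrite fz ge_min (ltW z0) le_max fL orbT.
rewrite in_itv /= => /andP[zl lL] fl.
have lt_zl : z < l.
  by rewrite lt_neqAle zl andbT; apply: contra_eq_neq fl => <-; rewrite fz lt_eqF.
exists l => //; have := pfrac_lt dz lt_zl; rewrite wz => wl.
by move/eqP: fl; rewrite subr_eq0 => /eqP {1}->; rewrite mulfK // gt_eqF.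
Qed.

End PartialFraction.

(** * Main eigenvalues of H *)

Section MainEigenvalues.
Local Open Scope classical_set_scope.
Context {R : realType} {H : sgraph}.
Hypothesis H_card : (1 <= #|H|)%N.
Variable s : seq R.
Hypothesis s_uniq : uniq s.
Hypothesis s_ev : eigenvalue (adj_mx R H) =i s.
Local Notation A := (adj_mx R H).
Local Notation J := (allone R #|H|).
Local Notation e := (@eigenproj1 R H).

Definition main_weight (a : R) : R := inner (e a) (e a).
Local Notation c := main_weight.

Definition main_seq : seq R := [seq a <- s | c a != 0].

Lemma ev_seq a : ev R H a <-> a \in s.
Proof. by rewrite -s_ev. Qed.

Lemma sum_eigenproj_seq (v : 'cV[R]_#|H|) : \sum_(a <- s) eigenproj H a *m v = v.
Proof. by apply: sum_eigenproj => // a; rewrite -s_ev. Qed.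

Lemma sum1_eigenproj_seq (v : 'cV[R]_#|H|) :
  \sum_(a <- s) 1 *: (eigenproj H a *m v) = v.
Proof. by under eq_bigr do rewrite scale1r; exact: sum_eigenproj_seq. Qed.

Lemma inner_eigenproj a b (u v : 'cV[R]_#|H|) : a != b ->
  inner (eigenproj H a *m u) (eigenproj H b *m v) = 0.
Proof. by apply: inner_eigen_neq; exact: eigenproj_eigen. Qed.

Lemma inner_sum_orthogonal (x y : R -> R) (p : R -> 'cV[R]_#|H|) :
  (forall a b, a != b -> inner (p a) (p b) = 0) ->
  inner (\sum_(a <- s) x a *: p a) (\sum_(a <- s) y a *: p a) =
  \sum_(a <- s) x a * y a * inner (p a) (p a).
Proof.
move=> orth_p; rewrite inner_suml big_seq [RHS]big_seq; apply: eq_bigr => a sa.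
rewrite inner_sumr (bigD1_seq a sa s_uniq) /= innerZl innerZr mulrA.
rewrite big1 ?addr0 // => b ba; rewrite innerZl innerZr.
by rewrite orth_p 1?eq_sym // !mulr0.
Qed.

Lemma inner_sum_eigenproj (x y : R -> R) (v : 'cV[R]_#|H|) :
  inner (\sum_(a <- s) x a *: (eigenproj H a *m v))
        (\sum_(a <- s) y a *: (eigenproj H a *m v)) =
  \sum_(a <- s) x a * y a * inner (eigenproj H a *m v) (eigenproj H a *m v).
Proof. by apply: inner_sum_orthogonal => a b; exact: inner_eigenproj. Qed.

Lemma sum_main_seq (F : R -> R) : \sum_(a <- main_seq) F a * c a = \sum_(a <- s) F a * c a.
Proof.
rewrite big_filter big_mkcond; apply: eq_bigr => a _.
by case: eqVneq => //= ->; rewrite mulr0.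
Qed.

Lemma adj_sum_eigenproj (x : R -> R) (v : 'cV[R]_#|H|) :
  A *m (\sum_(a <- s) x a *: (eigenproj H a *m v)) =
  \sum_(a <- s) (a * x a) *: (eigenproj H a *m v).
Proof.
rewrite mulmx_sumr; apply: eq_bigr => a _.
by rewrite -scalemxAr eigenproj_eigen scalerA mulrC.
Qed.

Lemma allone_inner : inner J J = #|H|%:R.
Proof.
rewrite /inner; under eq_bigr do rewrite mxE mulr1.
by rewrite sumr_const card_ord.
Qed.

Lemma sum_main_weight : \sum_(a <- s) c a = #|H|%:R.
Proof.
rewrite -allone_inner -(sum1_eigenproj_seq J) inner_sum_eigenproj.
by apply: eq_bigr => a _; rewrite !mul1r.
Qed.

(** The left side is <1, A 1>, the sum of the degrees of H, each at most [#|H| - 1]. *)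
Lemma sum_main_weight_ev : \sum_(a <- s) a * c a <= #|H|%:R * (#|H|%:R - 1).
Proof.
have -> : \sum_(a <- s) a * c a = inner J (A *m J).
  rewrite -(sum1_eigenproj_seq J) adj_sum_eigenproj inner_sum_eigenproj.
  by apply: eq_bigr => a _; rewrite mul1r mulr1.
rewrite /inner (_ : _ * _ = \sum_(i < #|H|) (#|H|%:R - 1)); last first.
  by rewrite sumr_const card_ord mulr_natl.
apply: ler_sum => i _; rewrite !mxE mul1r (bigD1 i) //= !mxE adj_irr mul0r add0r.
have -> : #|H|%:R - 1 = \sum_(j < #|H| | j != i) 1 :> R.
  by rewrite sumr_const cardC1 card_ord -subn1 natrB.
by apply: ler_sum => j _; rewrite !mxE mulr1 lern1 leq_b1.
Qed.

Lemma main_weight_gt0 : {in main_seq, forall a, 0 < c a}.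
Proof. by move=> a; rewrite mem_filter lt_def inner_ge0 => /andP[->]. Qed.

Lemma main_seq_sub a : a \in main_seq -> a \in s.
Proof. by rewrite mem_filter => /andP[]. Qed.

Lemma main_seq_neq0 : main_seq != [::].
Proof.
apply/eqP => s0; have := sum_main_seq (fun=> 1).
under [RHS]eq_bigr do rewrite mul1r.
by rewrite s0 big_nil sum_main_weight => /eqP; rewrite eq_sym pnatr_eq0 gtn_eqF.
Qed.

Lemma main_ev_seq : main_ev R H = [set` main_seq].
Proof.
apply/seteqP; split=> a /=; rewrite mem_filter /main_weight inner_eq0.
  by case=> /ev_seq -> ->.
by case/andP => ? /ev_seq.
Qed.

(** All poles [- a - 2] of omega_H are then negative, and the term for the eigenvalue -2 vanishes,
    so that the results on [pfrac] apply. *)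
Hypothesis s_gtN2 : {in s, forall a, -2 < a}.

Lemma main_seq_gt0 : {in main_seq, forall a, 0 < a + 2}.
Proof. by move=> a /main_seq_sub/s_gtN2; rewrite -ltrBlDr sub0r. Qed.

Lemma main_evD : main_ev R H `\ (- 2) = [set` main_seq].
Proof.
rewrite main_ev_seq; apply/seteqP; split=> a /= => [[]|sa] //; split=> // a2.
by have := main_seq_gt0 sa; rewrite a2 addNr ltxx.
Qed.

Local Notation w := (pfrac main_seq (fun a : R => a + 2) c).

Lemma omegaE l : omega H l = w l.
Proof.
rewrite /omega /pfrac main_evD -fsbig_seq ?filter_uniq //; congr (_ + _).
rewrite -[X in _ = X]addr0; congr (_ + _); apply/eqP.
rewrite inner_eq0; apply/negPn/negP => e0.
have /s_gtN2 : -2 \in s; last by rewrite ltxx.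
rewrite -s_ev; apply/eigenvalueP; exists (e (- 2))^T; last by rewrite trmx_eq0.
by apply/eigenspaceP/eigenspace_colP; exact: eigenproj_eigen.
Qed.

Lemma omega_polesE l : omega_poles R H l <-> exists2 a, a \in main_seq & a + 2 + l = 0.
Proof.
rewrite /omega_poles main_evD; split=> -[a sa al]; exists a => //.
  by rewrite -al; ring.
by apply/eqP; rewrite -subr_eq0; apply/eqP; rewrite -oppr0 -al; ring.
Qed.

(** The zero to the right of all the poles is the largest one, since omega_H is strictly increasing
    from there on. *)
Lemma lambda_starP : [/\ lambda_star R H < 0, w (lambda_star R H) = 0 &
  {in main_seq, forall a, 0 < a + 2 + lambda_star R H}].
Proof.
have [z [z0 dz wz]] := pfrac_zero main_seq_gt0 main_weight_gt0 main_seq_neq0.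
suff -> : lambda_star R H = z by [].
apply: max_of_eq => [|l [_]].
  split; last by rewrite omegaE.
  by move/omega_polesE => [a sa a0]; have := dz a sa; rewrite a0 ltxx.
rewrite omegaE leNgt => wl; apply/negP => zl.
by have := pfrac_lt main_seq_gt0 main_weight_gt0 main_seq_neq0 dz zl; rewrite wl wz ltxx.
Qed.

(** Above [lambda_star] there is no pole and omega_H is positive, so psi_H is the plain quotient
    there, strictly increasing and onto. *)
Lemma psi_star_invP q : let l := psi_star_inv H q in
  [/\ lambda_star R H < l, 0 < w l & l / w l = q].
Proof.
have [ls0 wls dls] := lambda_starP.
have gtw l : lambda_star R H < l -> 0 < w l.
  by move/(pfrac_lt main_seq_gt0 main_weight_gt0 main_seq_neq0 dls); rewrite wls.
have psiE l : lambda_star R H < l -> psi H l = l / w l.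
  move=> hl; rewrite /psi omegaE; case: asboolP => // /omega_polesE[a sa a0].
  by have := pfrac_dom_le (ltW hl) dls sa; rewrite a0 ltxx.
have [l hl lq] :=
  pfrac_ratio_surj main_seq_gt0 main_weight_gt0 main_seq_neq0 q dls ls0 wls.
suff -> : psi_star_inv H q = l by split=> //; exact: gtw.
(* With [q] written as [psi H l], the partial inverse cancels once [psi H] is injective on the
   half-line. *)
rewrite -lq -psiE // /psi_star_inv pinvKV ?inE // => x y.
rewrite !inE /= => hx hy; rewrite !psiE // => xy.
have mono u v : u < v -> lambda_star R H < u -> u / w u < v / w v.
  move=> uv hu; have du := pfrac_dom_le (ltW hu) dls.
  exact: (pfrac_ratio_lt main_seq_gt0 main_weight_gt0 main_seq_neq0 du (gtw _ hu) uv).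
by case: (ltgtP x y) => // /mono; rewrite xy ltxx => h; [have := h hx|have := h hy].
Qed.

Lemma psi_star_inv_ge (q : R) :
  {in s, forall a, - Num.sqrt (2 : R) < a} -> -1 <= q ->
  - 2 + Num.sqrt 2 <= psi_star_inv H q.
Proof.
move=> s_gt q1; have [ls_lt wl lq] := psi_star_invP q.
set l := psi_star_inv H q in ls_lt wl lq *.
have [_ _ dls] := lambda_starP; have dl := pfrac_dom_le (ltW ls_lt) dls.
rewrite leNgt; apply/negP; set r := Num.sqrt 2; set mu := _ + r => l_mu.
have r2 : r * r = 2 by rewrite -expr2 sqr_sqrtr.
have r0 : 0 < r by rewrite sqrtr_gt0.
have r1 : 1 < r by nra.
have rlt2 : r < 2 by nra.
have wmu : 0 < w mu.
  exact: lt_trans wl (pfrac_lt main_seq_gt0 main_weight_gt0 main_seq_neq0 dl l_mu).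
have := pfrac_ratio_lt main_seq_gt0 main_weight_gt0 main_seq_neq0 dl wl l_mu.
(* If [l < mu], monotonicity gives [-1 < mu / w mu]; it remains to refute this by [mu <= - w mu]. *)
rewrite lq => /(le_lt_trans q1); rewrite ltr_pdivlMr // mulN1r; apply/negP; rewrite -leNgt.
pose m : R := #|H|%:R; have m1 : 1 <= m by rewrite ler1n.
(* With the weights c, the mean of [a + r] is r plus the average degree of H,
   hence at most [m - 1 + r <= r m]: Jensen's inequality for [1/t], through its
   tangent line at [t = r m]. *)
have tangent a : a \in s -> 2 / (r * m) - (a + r) / (r * m) ^+ 2 <= (a + r)^-1.
  move=> /s_gt ar; have t0 : 0 < a + r by rewrite -ltrBlDr sub0r.
  set t := a + r in t0 *; set u := r * m; have u0 : 0 < u by rewrite mulr_gt0 //; lra.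
  rewrite -subr_ge0 (_ : _ - _ = (t - u) ^+ 2 / (t * u ^+ 2)); last first.
    by field; rewrite !gt_eqF.
  by rewrite divr_ge0 ?sqr_ge0 // mulr_ge0 ?sqr_ge0 // ltW.
have sum_ge : r / 2 <= \sum_(a <- s) (a + r)^-1 * c a.
  apply: (@le_trans _ _ (\sum_(a <- s) (2 / (r * m) - (a + r) / (r * m) ^+ 2) * c a)).
    have -> : \sum_(a <- s) (2 / (r * m) - (a + r) / (r * m) ^+ 2) * c a =
        (2 / (r * m) - r / (r * m) ^+ 2) * m - (\sum_(a <- s) a * c a) / (r * m) ^+ 2.
      rewrite -[X in _ * X - _]sum_main_weight mulr_sumr mulr_suml -sumrB.
      by apply: eq_bigr => a _; ring.
    have m2 : 0 < (r * m) ^+ 2 by rewrite exprn_gt0 // mulr_gt0 //; lra.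
    have := sum_main_weight_ev; rewrite -/m => sum_le.
    (* Because [r * r = 2], the middle term exceeds [r / 2] by [(r - 1) * (m - 1) / (2 * m)]. *)
    apply: (@le_trans _ _ ((2 / (r * m) - r / (r * m) ^+ 2) * m - m * (m - 1) / (r * m) ^+ 2)).
      rewrite -subr_ge0 (_ : _ - _ = (r - 1) * (m - 1) / (r * r * m)).
        apply: divr_ge0; first by rewrite mulr_ge0 ?subr_ge0 // ltW.
        by rewrite r2; lra.
      have -> : 2 / (r * m) = r / m by rewrite -r2; field; rewrite !gt_eqF //; lra.
      by rewrite exprMn expr2 r2; field; rewrite gt_eqF //; lra.
    by rewrite lerB // ler_pM2r // invr_gt0.
  rewrite big_seq [leRHS]big_seq; apply: ler_sum => a sa.
  by rewrite ler_wpM2r ?inner_ge0 // tangent.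
rewrite /pfrac (sum_main_seq (fun a => mu / (a + 2 + mu))).
have -> : \sum_(a <- s) mu / (a + 2 + mu) * c a = mu * \sum_(a <- s) (a + r)^-1 * c a.
  rewrite mulr_sumr; apply: eq_bigr => a _; rewrite mulrA; congr (_ / _ * _).
  by rewrite /mu; ring.
(* As [mu < 0], the bound [S >= r / 2] gives [1 + mu * S <= 1 + (r - 2) * r / 2 = 2 - r = - mu]. *)
move: sum_ge; set S := \sum_(a <- _) _; rewrite /mu => hS.
by clear -hS r2 r1 rlt2; nra.
Qed.

(** * Minimising the quadratic form on one copy of H *)

Section Copy.
Variable l : R.
Hypothesis l_gt : {in s, forall a, 0 < a + 2 + l}.
Implicit Types h v : 'cV[R]_#|H|.

Lemma shifted_form_ge0 h : 0 <= inner h (A *m h) + (2 + l) * inner h h.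
Proof.
have -> : inner h (A *m h) + (2 + l) * inner h h =
    \sum_(a <- s) (a + 2 + l) * inner (eigenproj H a *m h) (eigenproj H a *m h).
  rewrite -[X in inner X _ + _ * inner X _](sum1_eigenproj_seq h).
  rewrite -[X in inner _ (A *m X) + _ * inner _ X](sum1_eigenproj_seq h).
  rewrite adj_sum_eigenproj !inner_sum_eigenproj mulr_sumr -big_split.
  by apply: eq_bigr => a _ /=; ring.
rewrite big_seq sumr_ge0 // => a sa.
by rewrite mulr_ge0 ?inner_ge0 // ltW // l_gt.
Qed.

(** [v] is (A_H + 2 + l)^-1 1, built from the spectral decomposition; the second equation is the
    resolvent formula for omega_H. *)
Lemma resolvent_allone :
  exists2 v, A *m v + (2 + l) *: v = J & w l = 1 + l * inner J v.
Proof.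
exists (\sum_(a <- s) (a + 2 + l)^-1 *: (eigenproj H a *m J)).
  rewrite adj_sum_eigenproj scaler_sumr -big_split /= -[RHS]sum1_eigenproj_seq.
  rewrite big_seq [RHS]big_seq; apply: eq_bigr => a sa; rewrite scalerA -scalerDl.
  by congr (_ *: _); field; rewrite gt_eqF ?l_gt.
rewrite -[X in inner X _](sum1_eigenproj_seq J) inner_sum_eigenproj.
rewrite /pfrac (sum_main_seq (fun a => l / (a + 2 + l))) mulr_sumr.
by congr (_ + _); apply: eq_bigr => a _; rewrite mul1r mulrA.
Qed.

Hypothesis wl_gt0 : 0 < w l.

(** Completing the square: once [h] is written as [g + k *: v], the two sides differ by the form of
    A_H + 2 + l at [g] plus [l * inner J g ^+ 2]. *)
Lemma copy_form_min h t :
  l / w l * t ^+ 2 <=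
  inner h (A *m h) + (2 + l) * inner h h + l * (t - inner J h) ^+ 2.
Proof.
have [v Bv wE] := resolvent_allone.
have polar g k : inner (g + k *: v) (A *m (g + k *: v)) +
      (2 + l) * inner (g + k *: v) (g + k *: v) =
    inner g (A *m g) + (2 + l) * inner g g + 2 * k * inner J g + k ^+ 2 * inner J v.
  have Jg x : inner J x = inner v (A *m x) + (2 + l) * inner v x.
    by rewrite -Bv innerDl innerZl (inner_symmx _ _ adj_mx_sym).
  rewrite mulmxDr -scalemxAr !(innerDl, innerDr, innerZl, innerZr) !Jg.
  by rewrite (inner_symmx g v adj_mx_sym) (innerC (A *m g)) (innerC g v); ring.
(* [k *: v] is the critical point: the gradient vanishes there when [k = l * (t - k * inner J v)],
   that is [k * w l = l * t]. *)
set k := l / w l * t; pose g := h - k *: v.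
have hE : h = g + k *: v by rewrite subrK.
clearbody g; rewrite hE polar innerDr innerZr.
(* With [E g = <g, (A + 2 + l) g>] and [x = <1, g>], this nonnegativity gives
   [E g + l x^2 >= - l x^2 w(l)], which settles the case [l < 0]. *)
have := shifted_form_ge0 (g + (l * inner J g) *: v); rewrite polar.
have := shifted_form_ge0 g.
move: wl_gt0; rewrite /k wE.
set E := inner g _ + _; set x := inner J g; set b := inner J v => wb E0 E1.
have lE : 0 <= E + l * x ^+ 2.
  have [l0|l0] := leP 0 l; first by rewrite addr_ge0 // mulr_ge0 ?sqr_ge0.
  have : 0 <= - l * x ^+ 2 * (1 + l * b).
    apply: mulr_ge0; last exact: ltW.
    by rewrite mulr_ge0 ?sqr_ge0 // oppr_ge0 ltW.
  by move: E1; lra.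
rewrite -subr_ge0; move: lE; congr (0 <= _).
by field; rewrite gt_eqF.
Qed.

(** The minimiser is linear in [t], through one vector independent of [t]; the same [v] thus serves
    every copy when an extremal function on G is lifted. *)
Lemma copy_form_eq : exists v, forall t,
  inner (t *: v) (A *m (t *: v)) + (2 + l) * inner (t *: v) (t *: v) +
    l * (t - inner J (t *: v)) ^+ 2 = l / w l * t ^+ 2.
Proof.
have [v Bv wE] := resolvent_allone.
exists ((l / w l) *: v) => t; rewrite scalerA.
rewrite -scalemxAr !(innerZl, innerZr).
have Jv : inner J v = inner v (A *m v) + (2 + l) * inner v v.
  by rewrite -{1}Bv innerDl innerZl innerC.
have -> : inner v (A *m v) = inner J v - (2 + l) * inner v v by rewrite Jv addrK.
by move: wl_gt0; rewrite wE => wb; field; rewrite gt_eqF.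
Qed.

End Copy.
End MainEigenvalues.

(** * The distance form of a corona *)

Section Corona.
Context {R : realType} {G H : sgraph}.
Hypothesis G_connected : connected_graph G.
Local Notation A := (adj_mx R H).
Local Notation J := (allone R #|H|).

Lemma sum_corona (F : corona G H -> R) :
  \sum_a F a = \sum_x (F (inl x) + \sum_u F (inr (x, u))).
Proof.
rewrite big_sumType big_split /= pair_bigA /=; congr (_ + _).
by apply: eq_bigr => -[].
Qed.

Variable f : corona G H -> R.

Definition copy_vec (x : G) : 'cV[R]_#|H| := colfun (fun u => f (inr (x, u))).
Local Notation h := copy_vec.

Definition copy_total (x : G) : R := f (inl x) + inner J (h x).
Local Notation T := copy_total.

Lemma sum_copy_total : \sum_a f a = \sum_x T x.
Proof. by rewrite sum_corona; apply: eq_bigr => x _; rewrite /T inner1_colfun. Qed.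

Lemma sum_sqr_corona :
  \sum_a f a ^+ 2 = \sum_x ((T x - inner J (h x)) ^+ 2 + inner (h x) (h x)).
Proof.
rewrite sum_corona; apply: eq_bigr => x _; rewrite addrK inner_colfun.
by congr (_ + _); apply: eq_bigr => u _; rewrite expr2.
Qed.

(** Each endpoint in a copy adds 1 to the distance in G, up to a correction for pairs in the same
    copy, whose sum is the subtracted term. The added units contribute T_x S_y + S_x T_y, which sums
    to 0 because the T_x do. *)
Lemma dist_form_corona : \sum_a f a = 0 ->
  dist_form f = dist_form T - \sum_x (inner (h x) (A *m h x) + 2 * inner (h x) (h x)).
Proof.
move=> f0; pose g x := f (inl x); pose S x := inner J (h x).
have SE x : S x = \sum_u f (inr (x, u)) by rewrite /S inner1_colfun.
have T0 : \sum_x T x = 0 by rewrite -sum_copy_total.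
pose K x := inner (h x) (A *m h x) + 2 * inner (h x) (h x).
have KE x : K x = \sum_u \sum_v ((u == v)%:R *+ 2 + (adj u v)%:R) *
                    f (inr (x, u)) * f (inr (x, v)).
  rewrite /K inner_colfun -[X in X + _](_ : \sum_u \sum_v (adj u v)%:R *
    f (inr (x, u)) * f (inr (x, v)) = _).
    rewrite mulr_sumr -big_split /=; apply: eq_bigr => u _.
    under [RHS]eq_bigr do rewrite !mulrDl.
    rewrite big_split /= addrC; congr (_ + _).
    rewrite (bigD1 u) //= eqxx big1 ?addr0 => [|v vu]; first by rewrite /=; ring.
    by rewrite eq_sym (negPf vu) /= !mul0r addr0.
  rewrite /inner -[LHS]sum_enum_val; apply: eq_bigr => i _.
  rewrite !mxE -[LHS]sum_enum_val mulr_sumr; apply: eq_bigr => j _.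
  by rewrite !mxE; ring.
have row_inl x : \sum_b (dist (inl x : corona G H) b)%:R * g x * f b =
    \sum_y ((dist x y)%:R * g x * T y + g x * S y).
  rewrite sum_corona; apply: eq_bigr => y _; rewrite dist_corona //=.
  under eq_bigr do rewrite dist_corona //=.
  by rewrite -mulr_sumr -SE /T -/(g y) -/(S y) -natr1; ring.
have row_inr x u : \sum_b (dist (inr (x, u) : corona G H) b)%:R * f (inr (x, u)) * f b =
    \sum_y f (inr (x, u)) * ((dist x y)%:R * T y + g y + 2 * S y) -
    \sum_v ((u == v)%:R *+ 2 + (adj u v)%:R) * f (inr (x, u)) * f (inr (x, v)).
  (* Inside one copy the distance is 2 minus the entry of 2 I + A_H at [(u, v)]. *)
  have corr y v : (dist (inr (x, u) : corona G H) (inr (y, v)))%:R =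
      (dist x y)%:R + 2 - (x == y)%:R * ((u == v)%:R *+ 2 + (adj u v)%:R) :> R.
    rewrite dist_corona //=; case: eqVneq => [<-|_]; last first.
      by rewrite mul0r subr0 -natr1 -natr1 -addrA.
    rewrite dist_refl // mul1r; case: eqVneq => [->|_]; first by rewrite adj_irr /=; ring.
    by case: (adj u v) => /=; ring.
  rewrite sum_corona [X in _ = _ - X](_ : _ = \sum_y (x == y)%:R *
    \sum_v ((u == v)%:R *+ 2 + (adj u v)%:R) * f (inr (x, u)) * f (inr (y, v))); last first.
    rewrite [RHS](bigD1 x) //= eqxx mul1r [X in _ + X]big1 ?addr0 // => y.
    by rewrite eq_sym => /negPf ->; rewrite mul0r.
  rewrite -sumrB; apply: eq_bigr => y _; rewrite dist_corona //=.
  under eq_bigr do rewrite corr mulrBl mulrBl.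
  rewrite sumrB -mulr_sumr -SE.
  have -> : \sum_v (x == y)%:R * ((u == v)%:R *+ 2 + (adj u v)%:R) *
      f (inr (x, u)) * f (inr (y, v)) = (x == y)%:R *
      \sum_v ((u == v)%:R *+ 2 + (adj u v)%:R) * f (inr (x, u)) * f (inr (y, v)).
    by rewrite mulr_sumr; apply: eq_bigr => v _; rewrite !mulrA.
  rewrite /T -/(g y) -/(S y) -natr1; ring.
have cross (a b : G -> R) : \sum_x \sum_y a x * b y = (\sum_x a x) * (\sum_y b y).
  by rewrite mulr_suml; apply: eq_bigr => x _; rewrite mulr_sumr.
transitivity (\sum_x (\sum_y ((dist x y)%:R * T x * T y + T x * S y + S x * T y) - K x)).
  rewrite /dist_form sum_corona; apply: eq_bigr => x _; rewrite row_inl.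
  under [X in _ + X = _]eq_bigr do rewrite row_inr; rewrite sumrB -KE addrA; congr (_ - _).
  rewrite exchange_big -big_split /=; apply: eq_bigr => y _.
  by rewrite -mulr_suml -SE /T -/(g x) -/(S x) -/(g y) -/(S y); ring.
rewrite sumrB; congr (_ - _); rewrite /dist_form.
under eq_bigr do rewrite !big_split /=.
by rewrite !big_split /= !cross T0 mul0r mulr0 !addr0.
Qed.

End Corona.

(** * Passage from extremal functions on G to the corona *)

Lemma min_ev_lt (R : realType) (H : sgraph) (s : seq R) r :
  eigenvalue (adj_mx R H) =i s -> s != [::] -> r < min_of (ev R H) ->
  {in s, forall a, r < a}.
Proof.
move=> s_ev s0 r_lt; have lt0 : (0 < size s)%N by rewrite lt0n size_eq0.
have [k _ kmin] := @Order.TotalTheory.arg_minP _ _ _ (Ordinal lt0) xpredT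
  (fun k : 'I_(size s) => s`_k) isT.
have min_le a : a \in s -> s`_k <= a.
  move=> sa; have lta : (index a s < size s)%N by rewrite index_mem.
  by have := kmin (Ordinal lta) isT; rewrite /= nth_index.
(* The eigenvalues form a nonempty finite list, so [min_of] is attained and is not the default value
   0. *)
rewrite (@min_of_eq _ _ s`_k) in r_lt.
- by move=> a /min_le; apply: lt_le_trans.
- by apply/(ev_seq s_ev); exact: mem_nth.
by move=> a /(ev_seq s_ev); exact: min_le.
Qed.

Theorem theorem4p10 (R : realType) (G H : sgraph)
    (G_connected : connected_graph G)
    (G_card : (2 <= #|G|)%N) (H_card : (1 <= #|H|)%N)
    (cond_i : ~ ev R H (- 2 - psi_star_inv H (QEC R G)))
    (cond_ii : - Num.sqrt 2 < min_of (ev R H)) :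
  QEC R (corona G H) = psi_star_inv H (QEC R G).
Proof.
have char0 : char_poly (adj_mx R H) != 0 by rewrite monic_neq0 // char_poly_monic.
have [s s_uniq s_root] := poly_root_seq char0.
have s_ev : eigenvalue (adj_mx R H) =i s.
  by move=> a; rewrite -s_root -!topredE /= eigenvalue_root_char.
have s0 : s != [::].
  apply/eqP => s0; have := sum_main_weight s_uniq s_ev.
  by rewrite s0 big_nil => /eqP; rewrite eq_sym pnatr_eq0 gtn_eqF.
have s_gt := min_ev_lt s_ev s0 cond_ii.
have r0 : 0 <= Num.sqrt (2 : R) := sqrtr_ge0 _.
have r2 : Num.sqrt (2 : R) ^+ 2 = 2 by rewrite sqr_sqrtr.
have s_gtN2 : {in s, forall a, -2 < a}.
  by move=> a /s_gt; apply: lt_trans; nra.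
have [f [f0 f1 fq] qub] := QEC_max (R := R) G_card.
have qN1 := QEC_geN1 (R := R) G_connected G_card.
set q := QEC R G in fq qub qN1 *; set l := psi_star_inv H q.
have l_ge := psi_star_inv_ge H_card s_uniq s_ev s_gtN2 s_gt qN1.
have [_ wl lq] := psi_star_invP H_card s_uniq s_ev s_gtN2 q.
rewrite -/l in l_ge wl lq.
have l_gt : {in s, forall a, 0 < a + 2 + l} by move=> a /s_gt; lra.
have [v vE] := copy_form_eq s_uniq s_ev l_gt wl.
(* The lift of the extremal [f]: each copy carries the minimiser for [t = f x], and the value at
   [inl x] is chosen so that the total at [x] is [f x]. *)
pose F (a : corona G H) : R := match a with
  | inl x => f x - inner (allone R #|H|) (f x *: v)
  | inr (x, u) => f x * v (enum_rank u) 0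
  end.
have hF x : copy_vec F x = f x *: v.
  by apply/colP => i; rewrite !mxE /= enum_valK.
have TF x : copy_total F x = f x by rewrite /copy_total hF subrK.
(* The sum over [x] collects exactly the forms bounded below by [copy_form_min]. *)
have balance (g : corona G H -> R) : \sum_a g a = 0 ->
  dist_form g - l * \sum_a g a ^+ 2 = dist_form (copy_total g) -
    \sum_x (inner (copy_vec g x) (adj_mx R H *m copy_vec g x) +
      (2 + l) * inner (copy_vec g x) (copy_vec g x) +
      l * (copy_total g x - inner (allone R #|H|) (copy_vec g x)) ^+ 2).
  move=> g0; rewrite dist_form_corona // sum_sqr_corona -addrA -opprD mulr_sumr -big_split /=.
  by congr (_ - _); apply: eq_bigr => x _; ring.
have F0 : \sum_a F a = 0 by rewrite sum_copy_total -[RHS]f0; apply: eq_bigr.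
apply: (@QEC_unique _ _ _ F) => //.
- move=> g g0; rewrite -subr_le0 balance // subr_le0.
  apply: le_trans (qub _ _) _; first by rewrite -sum_copy_total.
  rewrite mulr_sumr; apply: ler_sum => x _; rewrite -lq.
  exact: (copy_form_min s_uniq s_ev l_gt wl).
(* If [F] vanished, so would its totals, which are the values of [f]. *)
- apply: contraPneq f1 => F2; rewrite big1; first by move/eqP; rewrite eq_sym oner_eq0.
  move=> x _; have Fa a : F a = 0.
    move/eqP: F2; rewrite psumr_eq0 => [/allP/(_ a (mem_index_enum a))|b _].
      by rewrite sqrf_eq0 => /eqP.
    exact: sqr_ge0.
  have hF0 : copy_vec F x = 0 by apply/colP => i; rewrite !mxE Fa.
  by rewrite -TF /copy_total Fa hF0 -(scale0r 0) innerZr mul0r addr0 expr0n.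
apply/eqP; rewrite -subr_eq0 balance // subr_eq0.
have -> : dist_form (copy_total F) = dist_form f.
  by congr dist_form; apply/funext.
apply/eqP; transitivity (q * \sum_x f x ^+ 2); first by rewrite f1 mulr1.
by rewrite mulr_sumr; apply: eq_bigr => x _; rewrite hF TF vE lq.
Qed.
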